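(* Let $0<\beta\leq1$, $0<\alpha<1$ and $h>0$. (i) Let $u\in C_{h}^{0,\beta}$ and $\alpha<\beta$. Then $(\delta_{\rm right})^{\alpha}u\in C_{h}^{0,\beta-\alpha}$ and $\|(\delta_{\rm right})^{\alpha}u\|_{C_{h}^{0,\beta-\alpha}}\leq C\|u\|_{C_{h}^{0,\beta}}$. (ii) Let $u\in C_{h}^{1,\beta}$ and $\alpha<\beta$. Then $(\delta_{\rm right})^{\alpha}u\in C_{h}^{1,\beta-\alpha}$ and $\|(\delta_{\rm right})^{\alpha}u\|_{C_{h}^{1,\beta-\alpha}}\leq C\|u\|_{C_{h}^{1,\beta}}$. (iii) Let $u\in C_{h}^{1,\beta}$ and $\alpha>\beta$. Then $(\delta_{\rm right})^{\alpha}u\in C_{h}^{0,\beta-\alpha+1}$ and $\|(\delta_{\rm right})^{\alpha}u\|_{C_{h}^{0,\beta-\alpha+1}}\leq C\|u\|_{C_{h}^{1,\beta}}$. (iv) Let $k\in\mathbb{N}_0$, $u\in C_{h}^{k,\beta}$ and assume that $k+\beta-\alpha$ is not an integer, with $\alpha<k+\beta$. Then $(\delta_{\rm right})^{\alpha}u\in C_{h}^{l,s}$, where $l$ is the integer part of $k+\beta-\alpha$ and $s=k+\beta-\alpha-l$. The positive constants $C$ are independent of $h$ and $u$.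
   Context: For $h>0$, $\mathbb{Z}_h=\{jh:j\in\mathbb{Z}\}$. For $u:\mathbb{Z}_h\to\mathbb{R}$, $\delta_{\rm right}u(nh)=\frac{u(nh)-u((n+1)h)}{h}$, $\delta_{\rm left}u(nh)=\frac{u(nh)-u((n-1)h)}{h}$, and for $l,s\in\mathbb{N}_0$, $\delta_{\rm right,left}^{l,s}=(\delta_{\rm right})^l(\delta_{\rm left})^s$. For $0<\alpha<1$ and bounded $u$, $$(\delta_{\rm right})^{\alpha}u(nh)=\frac{1}{h^{\alpha}}\sum_{j=0}^{\infty}\Lambda^\alpha(j)\big(u((n+j)h)-u(nh)\big),\qquad\Lambda^\alpha(m)=\binom{-\alpha-1+m}{m}=(-1)^m\binom{\alpha}{m}.$$ For $0<\beta\le1$ and $k\in\mathbb{N}_0$, the discrete Hölder space $C_h^{k,\beta}$ consists of the functions $u:\mathbb{Z}_h\to\mathbb{R}$ with finite norm $$\|u\|_{C_h^{k,\beta}}=\max_{l+s\le k}\sup_{m\in\mathbb{Z}}|\delta_{\rm right,left}^{l,s}u(mh)|+\max_{l+s=k}[\delta_{\rm right,left}^{l,s}u]_{C_h^{0,\beta}},\qquad [w]_{C_h^{0,\beta}}=\sup_{m\neq j}\frac{|w(jh)-w(mh)|}{h^\beta|j-m|^\beta}.$$ *)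

(* Defs.v *)
From HB Require Import structures.
From mathcomp Require Import all_boot all_order all_algebra.
From mathcomp Require Import ring lra.
From mathcomp Require Import all_classical all_reals all_analysis.
Import Order.TTheory GRing.Theory Num.Theory.
Import numFieldNormedType.Exports.

Set Implicit Arguments.
Unset Strict Implicit.
Unset Printing Implicit Defensive.

Local Open Scope classical_set_scope.
Local Open Scope ring_scope.

(** A function [u] on the mesh [Z_h = {j h : j in Z}], [h > 0], is encoded by
    [int -> R]: the value written [u n] here is the value of [u] at [n h]. *)

Section mesh.
Variable R : realType.
Implicit Types (h a b x : R) (u : int -> R) (n : int).

Definition delta_right h u : int -> R := fun n => (u n - u (n + 1)) / h.

Definition delta_left h u : int -> R := fun n => (u n - u (n - 1)) / h.

Definition delta_rl h (l s : nat) u : int -> R :=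
  iter l (delta_right h) (iter s (delta_left h) u).

(** Binomial coefficient with a real upper argument. *)
Definition gbinom x (m : nat) : R := (\prod_(i < m) (x - i%:R)) / m`!%:R.

Definition Lambda a (m : nat) : R := gbinom (- a - 1 + m%:R) m.

(** The series is a [lim] in [R], hence a meaningful value only when it
    converges; this is the case for bounded [u], see [cvg_frac_series]. *)
Definition frac_delta_right h a u : int -> R := fun n =>
  (h `^ a)^-1 * limn (series (fun j => Lambda a j * (u (n + j%:Z) - u n))).

(** Norms and seminorms take values in [\bar R], finiteness being membership in
    the space; [-oo] is only the neutral element of [maxe]. *)
Definition holder_seminorm h b u : \bar R :=
  ereal_sup [set (`|u p.1 - u p.2| / (h `^ b * `|(p.1 - p.2)%:~R| `^ b))%:E
            | p in [set p : int * int | p.1 != p.2]].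

Definition sup_norm u : \bar R := ereal_sup (range (fun n => `|u n|%:E)).

Definition holder_norm h (k : nat) b u : \bar R :=
  (\big[maxe/-oo]_(p : 'I_k.+1 * 'I_k.+1 | (p.1 + p.2 <= k)%N)
      sup_norm (delta_rl h p.1 p.2 u)
   + \big[maxe/-oo]_(p : 'I_k.+1 * 'I_k.+1 | (p.1 + p.2 == k)%N)
      holder_seminorm h b (delta_rl h p.1 p.2 u))%E.

Definition holder_space h (k : nat) b : set (int -> R) :=
  [set u | (holder_norm h k b u < +oo)%E].

Lemma LambdaE a m : Lambda a m = (-1) ^+ m * gbinom a m.
Proof.
rewrite /Lambda /gbinom mulrA; congr (_ / _).
rewrite -[in (-1) ^+ _](card_ord m) -prodr_const -big_split /=.
rewrite (reindex_inj rev_ord_inj) /=; apply: eq_bigr => i _.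
by rewrite natrB ?ltn_ord// -natr1; ring.
Qed.

Lemma LambdaS a m : Lambda a m.+1 = Lambda a m * ((m%:R - a) / m.+1%:R).
Proof.
rewrite !LambdaE /gbinom big_ord_recr /= factS natrM exprS.
have f0 : m`!%:R != 0 :> R by rewrite pnatr_eq0 -lt0n fact_gt0.
have s0 : m.+1%:R != 0 :> R by rewrite pnatr_eq0.
by field; rewrite f0 addrC natr1 s0.
Qed.

Lemma sum_Lambda a m :
  \sum_(0 <= j < m) Lambda a j * a = - (Lambda a m * m%:R).
Proof.
elim: m => [|m IH]; first by rewrite big_geq// mulr0 oppr0.
have s0 : m.+1%:R != 0 :> R by rewrite pnatr_eq0.
rewrite big_nat_recr//= IH LambdaS.
by field; rewrite addrC natr1 s0.
Qed.

Lemma Lambda_le0 a m : 0 < a < 1 -> Lambda a m.+1 <= 0.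
Proof.
move=> /andP[a0 a1]; elim: m => [|m IH].
  rewrite LambdaS LambdaE /gbinom big_ord0 expr0 fact0; lra.
rewrite LambdaS; apply: mulr_le0_ge0 => //.
rewrite divr_ge0 ?subr_ge0// (le_trans (ltW a1))//.
by rewrite ler1n.
Qed.

Lemma sum_normLambda_le a m : 0 < a < 1 ->
  \sum_(0 <= j < m) `|Lambda a j| <= 2.
Proof.
move=> a01; have /andP[a0 a1] := a01.
have L0 : Lambda a 0 = 1 by rewrite LambdaE /gbinom big_ord0 fact0 expr0; lra.
case: m => [|m]; first by rewrite big_geq.
have H : 0 <= \sum_(0 <= j < m.+1) Lambda a j.
  rewrite -(pmulr_lge0 _ a0) mulr_suml sum_Lambda oppr_ge0.
  by rewrite mulr_le0_ge0// Lambda_le0.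
move: H; rewrite !big_nat_recl//= L0 normr1.
under [X in _ -> _ + X <= _]eq_bigr do rewrite ler0_norm ?Lambda_le0//.
rewrite sumrN; lra.
Qed.

Lemma cvg_frac_series a u n : 0 < a < 1 -> (sup_norm u < +oo)%E ->
  cvgn (series (fun j => Lambda a j * (u (n + j%:Z) - u n))).
Proof.
move=> a01 uoo.
have u_ub j : (`|u j|%:E <= sup_norm u)%E by apply: ereal_sup_ubound; exists j.
have [M uM] : exists M, forall j, `|u j| <= M.
  exists (fine (sup_norm u)) => j; rewrite -lee_fin fineK//.
  by rewrite fin_numElt uoo andbT (lt_le_trans _ (u_ub j))// ltNyr.
apply: (@normed_cvg _ (R^o)); apply: nondecreasing_is_cvgn.
  by rewrite /normed_series_of; apply: nondecreasing_series => i _ _ /=; exact: normr_ge0.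
exists (2 * (M + M)) => _ [m _ <-]; rewrite /normed_series_of /series/=.
have M0 : 0 <= M by exact: le_trans (uM 0).
apply: (@le_trans _ _ (\sum_(0 <= j < m) `|Lambda a j| * (M + M))).
  apply: ler_sum => j _; rewrite normrM ler_wpM2l//.
  by rewrite (le_trans (ler_normB _ _))// lerD.
by rewrite -mulr_suml ler_wpM2r ?addr_ge0// sum_normLambda_le.
Qed.

End mesh.

(* Main.v *)
(** Everything reduces to bounding [\sum_j |Lambda j| * |u (n + j) - u n|] and
    its analogue for [w = u (. + N) - u], since the fractional difference is
    linear and commutes with translations.  The partial sums [T m] of [Lambda]
    satisfy [0 <= T m <= m^(-a)], by induction and Bernoulli's inequality, so
    summation by parts gives, without any estimate of [Lambda] itself,
      [\sum_j |Lambda j| * min(j, t)^b <= b / (b - a) * t^(b - a)]  for [a < b],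
    and a companion bound with [max] for [b < a].  Taking [t = 1 / h] bounds the
    supremum, uniformly in [h]; taking [t = N] bounds the Hölder seminorm.  When
    [b < a], the increments of [w] are at most
    [A h^(1 + b) min(j, N) max(j, N)^b], which both sums control together.  In
    part (iv) the mesh size is fixed, and there every bounded function lies in
    every Hölder space. *)

Require Import Defs.
From mathcomp Require Import all_boot all_order all_algebra.
From mathcomp Require Import ring lra zify.
From mathcomp Require Import all_classical all_reals all_analysis.
Import Order.TTheory GRing.Theory Num.Theory.
Import numFieldNormedType.Exports.
Local Open Scope ring_scope.

(** * Bernoulli inequalities for real exponents and a comparison of power increments *)

Section real_powers.
Context {R : realType}.
Implicit Types a b p s t x y : R.

(** [expR x >= 1 + x] at [x = p * ln s], then [ln s <= s - 1] multiplied by the nonpositive [p]. *)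
Lemma bernoulli_powR_le0 p s : 0 < s -> p <= 0 -> 1 + p * (s - 1) <= s `^ p.
Proof.
move=> s0 p0; rewrite /powR gt_eqF//.
apply: le_trans (expR_ge1Dx _); rewrite lerD2l ler_wnM2l//.
by have := @le_ln1Dx R (s - 1); rewrite subrKC; apply; lra.
Qed.

Lemma powRV x p : 0 <= x -> x^-1 `^ p = (x `^ p)^-1.
Proof. by move=> x0; rewrite -powR_inv1// -powRrM mulN1r powRN. Qed.

(** The nonpositive case at base [s^-1] and exponent [1 - p], multiplied by [s]. *)
Lemma bernoulli_powR_ge1 p s : 0 < s -> 1 <= p -> 1 + p * (s - 1) <= s `^ p.
Proof.
move=> s0 p1.
have sge0 := ltW s0.
have si0 : 0 < s^-1 by rewrite invr_gt0.
have p0 : 1 - p <= 0 by lra.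
have := bernoulli_powR_le0 _ _ si0 p0.
rewrite powRV// -powRN opprB powRB ?(gt_eqF s0) ?implybT// powRr1//.
rewrite ler_pdivlMr//; apply: le_trans.
rewrite le_eqVlt; apply/orP; left; apply/eqP.
by field; rewrite gt_eqF.
Qed.

(** Discrete form of [x^(-a) d(x^b) = b/(b-a) d(x^(b-a))]. It is Bernoulli at [s = (y/x)^(b-a)] with
    exponent [b/(b-a)], which is at least 1 when [a < b] and negative when [b < a]; one inequality
    thus serves both regimes. *)
Lemma powR_diff_le a b x y : 0 <= a -> 0 < b -> a != b -> 0 < x -> 0 < y ->
  x `^ (- a) * (x `^ b - y `^ b)
    <= b / (b - a) * (x `^ (b - a) - y `^ (b - a)).
Proof.
move=> a0 b0 ab x0 y0; have [xge0 yge0] := (ltW x0, ltW y0).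
have ba0 : b - a != 0 by rewrite subr_eq0 eq_sym.
pose s := (y / x) `^ (b - a).
have s0 : 0 < s by rewrite powR_gt0 ?divr_gt0.
have : 1 + b / (b - a) * (s - 1) <= s `^ (b / (b - a)).
  have [ba|ba] := ltrP 0 (b - a).
    by apply: bernoulli_powR_ge1; rewrite // ler_pdivlMr// mul1r; lra.
  by apply: bernoulli_powR_le0; rewrite // mulr_ge0_le0 ?ltW// invr_lt0 lt_neqAle ba0.
rewrite (_ : s `^ (b / (b - a)) = (y / x) `^ b); last first.
  by rewrite -powRrM [(b - a) * _]mulrC divfK.
have -> : s = y `^ (b - a) / x `^ (b - a).
  by rewrite /s powRM ?invr_ge0// powRV.
rewrite powRM ?invr_ge0// powRV//.
have xb0 : 0 < x `^ (b - a) by exact: powR_gt0.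
have xb : x `^ b = x `^ (b - a) * x `^ a.
  by rewrite -powRD ?subrK// (gt_eqF x0) implybT.
have xa0 : 0 < x `^ a by exact: powR_gt0.
rewrite -(ler_pM2l xb0) powRN xb => H.
have -> : (x `^ a)^-1 * (x `^ (b - a) * x `^ a - y `^ b) =
   x `^ (b - a) * (1 - y `^ b / (x `^ (b - a) * x `^ a)).
  by field; rewrite !gt_eqF.
move: H; set Y := y `^ b / _ ; set z := y `^ (b - a).
rewrite (_ : x `^ (b - a) * (1 + _) = x `^ (b - a) - b / (b - a) * (x `^ (b - a) - z)).
  by lra.
by field; rewrite ba0 gt_eqF.
Qed.

End real_powers.

(** * Partial sums of [Lambda] and weighted sums of its absolute values *)

Section Lambda_sums.
Context {R : realType}.
Implicit Types a b t : R.

Definition Lambda_psum a (m : nat) : R := \sum_(0 <= j < m) Lambda a j.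

Lemma Lambda_psumS a m : Lambda_psum a m.+1 = Lambda_psum a m + Lambda a m.
Proof. by rewrite /Lambda_psum big_nat_recr. Qed.

(** Recasts [sum_Lambda] as a recursion: each new partial sum is the previous one times
    [1 - a / m.+1%:R]. *)
Lemma LambdaS_psum a m :
  Lambda a m.+1 = - (a / m.+1%:R * Lambda_psum a m.+1).
Proof.
have m0 : m.+1%:R != 0 :> R by rewrite pnatr_eq0.
have := sum_Lambda a m.+1; rewrite -mulr_suml -/(Lambda_psum a m.+1) => E.
rewrite mulrAC [a * _]mulrC E; field.
by rewrite addrC natr1.
Qed.

Lemma Lambda_psum_ge0 a m : 0 < a < 1 -> 0 <= Lambda_psum a m.
Proof.
case: m => [|m] a01; first by rewrite /Lambda_psum big_geq.
have /andP[a0 _] := a01; have := Lambda_le0 m a01.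
by rewrite LambdaS_psum oppr_le0 pmulr_rge0// divr_gt0.
Qed.

(** Induction through that recursion: the factor [1 - a/(m+1)] is at most [((m+2)/(m+1))^(-a)] by
    Bernoulli with exponent [-a]. *)
Lemma Lambda_psum_le a m : 0 < a < 1 ->
  Lambda_psum a m.+1 <= m.+1%:R `^ (- a).
Proof.
move=> a01; have /andP[a0 a1] := a01; elim: m => [|m IH].
  rewrite Lambda_psumS /Lambda_psum big_geq// LambdaE /gbinom big_ord0 fact0.
  by rewrite powR1 expr0 mul1r divr1 add0r.
have m0 : 0 < m.+1%:R :> R by rewrite ltr0n.
have mm0 : 0 < m.+2%:R / m.+1%:R :> R by rewrite divr_gt0 ?ltr0n.
have am0 : 0 <= 1 - a / m.+1%:R.
  rewrite subr_ge0 ler_pdivrMr// mul1r (le_trans (ltW a1))//.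
  by rewrite ler1n.
rewrite Lambda_psumS LambdaS_psum.
rewrite (_ : _ - _ = Lambda_psum a m.+1 * (1 - a / m.+1%:R)); last by ring.
apply: le_trans (ler_wpM2r am0 IH) _.
have -> : m.+2%:R = m.+1%:R * (m.+2%:R / m.+1%:R) :> R.
  by rewrite mulrC divfK// gt_eqF.
rewrite powRM ?(ltW m0) ?(ltW mm0)// ler_wpM2l ?powR_ge0//.
apply: le_trans (@bernoulli_powR_le0 _ (- a) _ mm0 _); last by lra.
rewrite -[m.+2]addn1 natrD le_eqVlt; apply/orP; left; apply/eqP.
by field; rewrite addrC natr1 gt_eqF.
Qed.

(* Summation by parts against the partial sums of [Lambda], whose increments
   are [- `|Lambda|] after the first one. *)
Lemma sum_normLambda_mul_le a (f g : nat -> R) m : 0 < a < 1 ->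
  f 0%N = 0 -> (forall j, f j <= f j.+1) ->
  (forall j, j.+1%:R `^ (- a) * (f j.+1 - f j) <= g j.+1 - g j) ->
  \sum_(0 <= j < m) `|Lambda a j| * f j <= g m.-1 - g 0%N.
Proof.
move=> a01 f0 fS gS.
case: m => [|m]; first by rewrite big_geq// subrr.
have f_ge0 j : 0 <= f j by elim: j => [|j IH]; rewrite ?f0// (le_trans IH).
(* Keeping the nonnegative boundary term closes the induction: one more index then adds exactly
   [Lambda_psum a m.+1 * (f m.+1 - f m)] to the left side. *)
suff: \sum_(0 <= j < m.+1) `|Lambda a j| * f j
    + Lambda_psum a m.+1 * f m <= g m - g 0%N.
  by apply: le_trans; rewrite lerDl mulr_ge0 ?Lambda_psum_ge0.
elim: m => [|m IH]; first by rewrite big_nat1 f0 !mulr0 addr0 subrr.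
rewrite big_nat_recr//= ler0_norm ?Lambda_le0// (Lambda_psumS _ m.+1).
have df_ge0 : 0 <= f m.+1 - f m by rewrite subr_ge0.
have := ler_wpM2r df_ge0 (Lambda_psum_le _ m a01); have := gS m; move: IH.
set S := \sum_(_ <= _ < _) _; lra.
Qed.

Lemma sum_Lambda_minr_le a b t m : 0 < a < 1 -> a < b -> 0 < t ->
  \sum_(0 <= j < m) `|Lambda a j| * Num.min j%:R t `^ b
    <= b / (b - a) * t `^ (b - a).
Proof.
move=> a01 ab t0; have /andP[a0 a1] := a01.
have b0 : 0 < b by lra.
have ba0 : 0 < b - a by lra.
have tge0 := ltW t0.
have c0 : 0 <= b / (b - a) by rewrite divr_ge0 ?ltW.
have min_ge0 j : 0 <= Num.min j%:R t by rewrite le_min ler0n ltW.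
have minS j : Num.min j%:R t <= Num.min j.+1%:R t.
  by rewrite le_min !ge_min lexx orbT ler_nat leqnSn.
have min0 : Num.min 0%:R t = 0 by rewrite min_l.
pose g j := b / (b - a) * Num.min j%:R t `^ (b - a).
apply: (@le_trans _ _ (g m.-1 - g 0%N)).
  apply: sum_normLambda_mul_le => //.
  - by rewrite min0 powR0// gt_eqF.
  - by move=> j; rewrite ge0_ler_powR// ?nnegrE// ltW.
  - move=> j; rewrite -mulrBr.
    have x0 : 0 < Num.min j.+1%:R t by rewrite lt_min ltr0n.
    set x := Num.min j.+1%:R t in x0 *.
    (* As [x <= j+1], the factor [(j+1)^(-a)] may be replaced by the larger [x^(-a)]. *)
    apply: (@le_trans _ _ (x `^ (- a) * (x `^ b - Num.min j%:R t `^ b))).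
      apply: ler_wpM2r; first by rewrite subr_ge0 ge0_ler_powR// ?nnegrE// ltW.
      rewrite !powRN lef_pV2 ?posrE ?powR_gt0 ?ltr0n//.
      by rewrite ge0_ler_powR ?nnegrE// /x ?ge_min ?lexx// ltW.
    (* At [j = 0] the lower endpoint is 0, which [powR_diff_le] excludes; the claim reduces to
       [1 <= b/(b-a)]. *)
    case: j @x x0 => [|j] x x0.
      rewrite min0 !powR0 ?(gt_eqF b0) ?(gt_eqF ba0)// !subr0.
      rewrite -powRD ?(gt_eqF x0) ?implybT//.
      rewrite addrC -[X in X <= _]mul1r ler_wpM2r ?powR_ge0//.
      by rewrite ler_pdivlMr//; lra.
    by apply: powR_diff_le; rewrite ?(ltW a0) ?lt_eqF// lt_min ltr0n.
rewrite /g min0 powR0 ?gt_eqF// mulr0 subr0 ler_wpM2l//.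
by rewrite ge0_ler_powR ?nnegrE// ?ge_min ?lexx ?orbT// ltW.
Qed.

(** Subtracting [t^b] makes the weight vanish at [j = 0]. Since [b < a], the primitive [g] is
    nonpositive, and [- g 0] is the bound. *)
Lemma sum_Lambda_maxr_le a b t m : 0 < a < 1 -> 0 < b < a -> 0 < t ->
  \sum_(0 <= j < m) `|Lambda a j| * (Num.max j%:R t `^ b - t `^ b)
    <= b / (a - b) * t `^ (b - a).
Proof.
move=> a01 /andP[b0 ba] t0; have /andP[a0 a1] := a01.
have c0 : b / (b - a) <= 0 by rewrite mulr_ge0_le0 ?invr_le0; lra.
have max_gt0 j : 0 < Num.max j%:R t by rewrite lt_max t0 orbT.
have maxS j : Num.max j%:R t <= Num.max j.+1%:R t.
  by rewrite ge_max !le_max lexx orbT ler_nat leqnSn.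
have max0 : Num.max 0%:R t = t by rewrite max_r// ltW.
pose g j := b / (b - a) * Num.max j%:R t `^ (b - a).
apply: (@le_trans _ _ (g m.-1 - g 0%N)).
  apply: sum_normLambda_mul_le => //.
  - by rewrite max0 subrr.
  - by move=> j; rewrite lerB// ge0_ler_powR ?nnegrE// ltW.
  - move=> j; rewrite -mulrBr opprB addrA subrK.
    (* Up to [t] the weight is constant; beyond it the maximum is [j+1] itself, so [powR_diff_le]
       applies at [x = j+1]. *)
    have [jt|jt] := leP j.+1%:R t.
      rewrite (max_r (_ : j%:R <= t)) ?(le_trans _ jt) ?ler_nat//.
      by rewrite !subrr !mulr0.
    have x0 : 0 < j.+1%:R :> R by rewrite ltr0n.
    apply: le_trans (@powR_diff_le _ a _ _ _ _ _ _ x0 (max_gt0 j)) _ => //.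
    + exact: ltW.
    + by rewrite gt_eqF.
rewrite /g max0 lerBlDr -[a - b]opprB invrN mulrN mulNr addNr.
by rewrite mulr_le0_ge0 ?powR_ge0.
Qed.

End Lambda_sums.

(** * Pointwise bounds for the fractional difference and its increments *)

Section frac_estimates.
Context {R : realType}.
Implicit Types (a b c h A M : R) (u v : int -> R).

Lemma sup_norm_le u M : (forall n, `|u n| <= M) -> (sup_norm u <= M%:E)%E.
Proof. by move=> uM; apply: ge_ereal_sup => _ [n _ <-]; rewrite lee_fin. Qed.

Lemma is_cvg_frac_series a u M n : 0 < a < 1 -> (forall n, `|u n| <= M) ->
  cvgn (series (fun j => Lambda a j * (u (n + j%:Z) - u n))).
Proof.
move=> a01 uM; apply: cvg_frac_series => //.
by rewrite (le_lt_trans (sup_norm_le _ _ uM))// ltry.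
Qed.

(** [M] secures convergence, so that [limn] is the sum of the series; the size of the bound comes
    from [B]. *)
Lemma norm_frac_delta_right_le h a u M n B : 0 < h -> 0 < a < 1 ->
  (forall n, `|u n| <= M) ->
  (forall m, \sum_(0 <= j < m) `|Lambda a j| * `|u (n + j%:Z) - u n| <= B) ->
  `|frac_delta_right h a u n| <= (h `^ a)^-1 * B.
Proof.
move=> h0 a01 uM sB; have cu := is_cvg_frac_series _ _ _ n a01 uM.
rewrite /frac_delta_right normrM ger0_norm ?invr_ge0 ?powR_ge0//.
rewrite ler_wpM2l ?invr_ge0 ?powR_ge0// ler_norml.
have sn m : `|series (fun j => Lambda a j * (u (n + j%:Z) - u n)) m| <= B.
  apply: le_trans (sB m); apply: le_trans (ler_norm_sum _ _ _) _.
  by apply: ler_sum => j _; rewrite normrM.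
apply/andP; split.
  apply: limr_ge => //; apply: nearW => m.
  by have := sn m; rewrite ler_norml => /andP[].
apply: limr_le => //; apply: nearW => m.
by have := sn m; rewrite ler_norml => /andP[].
Qed.

(** The shape [c * (u - v)] covers both increments ([c = 1]) and difference quotients
    ([c = h^-1]). *)
Lemma frac_delta_right_lin h a c u v M n : 0 < a < 1 ->
  (forall n, `|u n| <= M) -> (forall n, `|v n| <= M) ->
  frac_delta_right h a (fun k => c * (u k - v k)) n
    = c * (frac_delta_right h a u n - frac_delta_right h a v n).
Proof.
move=> a01 uM vM.
have cu := is_cvg_frac_series _ _ _ n a01 uM.
have cv := is_cvg_frac_series _ _ _ n a01 vM.
rewrite /frac_delta_right -mulrBr mulrCA; congr (_ * _).
have -> : (fun j => Lambda a j * (c * (u (n + j%:Z) - v (n + j%:Z)) - c * (u n - v n)))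
  = c *: ((fun j => Lambda a j * (u (n + j%:Z) - u n) : R^o)
         - (fun j => Lambda a j * (v (n + j%:Z) - v n))).
  by apply/funext => j; rewrite /= !fctE /GRing.scale/=; ring.
have cuv := is_cvg_seriesB cu cv.
by rewrite lim_seriesZ// lim_seriesB.
Qed.

Lemma frac_delta_right_shift h a u (d n : int) :
  frac_delta_right h a (fun k => u (k + d)) n = frac_delta_right h a u (n + d).
Proof.
rewrite /frac_delta_right; congr (_ * _).
by under [in LHS]eq_fun do rewrite addrAC.
Qed.

Lemma frac_delta_right_diff h a u M (d n : int) : 0 < a < 1 ->
  (forall n, `|u n| <= M) ->
  frac_delta_right h a u (n + d) - frac_delta_right h a u n
    = frac_delta_right h a (fun k => u (k + d) - u k) n.
Proof.
move=> a01 uM.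
have -> : (fun k => u (k + d) - u k) = (fun k => 1 * (u (k + d) - u k)).
  by apply/funext => k; rewrite mul1r.
rewrite (@frac_delta_right_lin h a 1 (fun k => u (k + d)) u M)//.
by rewrite mul1r frac_delta_right_shift.
Qed.

Lemma delta_right_frac h a u M : 0 < a < 1 -> (forall n, `|u n| <= M) ->
  delta_right h (frac_delta_right h a u)
    = frac_delta_right h a (delta_right h u).
Proof.
move=> a01 uM; apply/funext => n; rewrite [LHS]mulrC.
have -> : delta_right h u = (fun k => h^-1 * (u k - u (k + 1))).
  by apply/funext => k; rewrite mulrC.
rewrite (@frac_delta_right_lin h a _ u (fun k => u (k + 1)) M)//.
by rewrite frac_delta_right_shift.
Qed.

Lemma delta_left_frac h a u M : 0 < a < 1 -> (forall n, `|u n| <= M) ->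
  delta_left h (frac_delta_right h a u)
    = frac_delta_right h a (delta_left h u).
Proof.
move=> a01 uM; apply/funext => n; rewrite [LHS]mulrC.
have -> : delta_left h u = (fun k => h^-1 * (u k - u (k + (- 1)))).
  by apply/funext => k; rewrite mulrC.
rewrite (@frac_delta_right_lin h a _ u (fun k => u (k + (- 1))) M)//.
by rewrite frac_delta_right_shift.
Qed.

(** Crude bound from the summability of [Lambda]. It blows up as [h] tends to 0, so it only serves
    part (iv). *)
Lemma frac_delta_right_bounded h a u M n : 0 < h -> 0 < a < 1 ->
  (forall n, `|u n| <= M) ->
  `|frac_delta_right h a u n| <= (h `^ a)^-1 * (2 * (M + M)).
Proof.
move=> h0 a01 uM; apply: (norm_frac_delta_right_le _ _ _ M) => // m.
have M0 : 0 <= M + M by have := normr_ge0 (u n); have := uM n; lra.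
apply: le_trans (ler_wpM2r M0 (sum_normLambda_le m a01)).
rewrite mulr_suml; apply: ler_sum => j _; rewrite ler_wpM2l//.
by rewrite (le_trans (ler_normB _ _))// lerD.
Qed.

(** Common source of the supremum and seminorm bounds when [a < b]: increments grow like a Hölder
    modulus up to distance [h * t], then stay bounded. *)
Lemma frac_delta_right_cutoff h a b u M n A t : 0 < h -> 0 < a < 1 -> a < b ->
  0 < t -> (forall n, `|u n| <= M) ->
  (forall j : nat, `|u (n + j%:Z) - u n| <= A * (h * Num.min j%:R t) `^ b) ->
  `|frac_delta_right h a u n| <= b / (b - a) * A * (h * t) `^ (b - a).
Proof.
move=> h0 a01 ab t0 uM uA; have [hge0 tge0] := (ltW h0, ltW t0).
have b0 : 0 < b by lra.
(* The sign of [A] is read off at [j = 1], where the modulus is positive. *)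
have A0 : 0 <= A.
  have := uA 1%N; rewrite -(@pmulr_lge0 _ ((h * Num.min 1%:R t) `^ b)).
    exact: le_trans.
  by rewrite powR_gt0// mulr_gt0// lt_min ltr01.
have ha0 : 0 < h `^ a by exact: powR_gt0.
have -> : b / (b - a) * A * (h * t) `^ (b - a)
    = (h `^ a)^-1 * (A * h `^ b * (b / (b - a) * t `^ (b - a))).
  rewrite powRM// [h `^ (b - a)]powRB ?(gt_eqF h0) ?implybT//.
  by field; rewrite !gt_eqF ?subr_gt0.
apply: (norm_frac_delta_right_le _ _ _ M) => // m.
have c0 : 0 <= A * h `^ b by rewrite mulr_ge0 ?powR_ge0.
apply: le_trans (ler_wpM2l c0 (sum_Lambda_minr_le _ _ _ m a01 ab t0)).
rewrite mulr_sumr; apply: ler_sum => j _.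
rewrite [leRHS]mulrCA ler_wpM2l// -mulrA -powRM// le_min.
by rewrite ler0n.
Qed.

Lemma frac_delta_right_sup h a b u A n : 0 < h -> 0 < a < 1 -> a < b ->
  (forall n, `|u n| <= A) ->
  (forall n (j : nat), `|u (n + j%:Z) - u n| <= A * (h * j%:R) `^ b) ->
  `|frac_delta_right h a u n| <= b / (b - a) * (2 * A).
Proof.
move=> h0 a01 ab uA uH; have b0 : 0 < b by lra.
have A0 : 0 <= A by exact: le_trans (uA 0).
have hi0 : 0 < h^-1 by rewrite invr_gt0.
(* The cutoff [t = h^-1] is distance 1; beyond it the increment is at most [2 * A] by the triangle
   inequality, whence the factor 2. *)
apply: le_trans (@frac_delta_right_cutoff h a b u A n (2 * A) h^-1 _ _ _ _ _ _) _ => //.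
  move=> j; have [jh|jh] := leP j%:R h^-1.
    by apply: le_trans (uH n j) _; rewrite -mulrA ler_peMl ?mulr_ge0 ?powR_ge0//; lra.
  rewrite mulfV ?gt_eqF// powR1 mulr1 mulr_natl mulr2n.
  by rewrite (le_trans (ler_normB _ _))// lerD.
by rewrite mulfV ?gt_eqF// powR1 mulr1.
Qed.

Lemma frac_delta_right_holder h a b u A n (N : nat) :
  0 < h -> 0 < a < 1 -> a < b -> (forall n, `|u n| <= A) ->
  (forall n (j : nat), `|u (n + j%:Z) - u n| <= A * (h * j%:R) `^ b) ->
  `|frac_delta_right h a u (n + N%:Z) - frac_delta_right h a u n|
    <= b / (b - a) * (2 * A) * (h * N%:R) `^ (b - a).
Proof.
move=> h0 a01 ab uA uH; have [a0 b0] : 0 < a /\ 0 < b by split; lra.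
case: N => [|N].
  by rewrite addr0 subrr normr0 mulr0 powR0 ?mulr0// gt_eqF// subr_gt0.
rewrite (frac_delta_right_diff h a u A)//.
apply: (@frac_delta_right_cutoff _ _ _ _ (A + A)); rewrite ?ltr0n//.
  by move=> k; rewrite (le_trans (ler_normB _ _))// lerD.
(* The second difference regroups into two increments of [u] of length [j] or two of length [N]; the
   shorter length is chosen. *)
move=> j; rewrite mulr_natl mulr2n mulrDl; have [jN|jN] := leP j%:R N.+1%:R.
  rewrite opprB [u n - _]addrC addrACA [- u _ + u n]addrC -[u n - _]opprB.
  rewrite (addrAC n).
  by rewrite (le_trans (ler_normB _ _))// lerD.
by rewrite (le_trans (ler_normB _ _))// lerD.
Qed.

(** Telescoping of a second difference into [i] unit steps. *)
Lemma iter_increment_le u (p q : int) (i : nat) K :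
  (forall m : int, `|(u (p + m + 1) - u (p + m)) - (u (q + m + 1) - u (q + m))| <= K) ->
  `|(u (p + i%:Z) - u p) - (u (q + i%:Z) - u q)| <= i%:R * K.
Proof.
move=> uK; elim: i => [|i IH]; first by rewrite !addr0 !subrr normr0 mul0r.
rewrite -natr1 mulrDl mul1r -addn1 PoszD !addrA.
have := le_trans (ler_normD _ _) (lerD IH (uK i)).
by congr (`|_| <= _); ring.
Qed.

(** The exponent 1 is written out so that this feeds [frac_delta_right_sup] at [b = 1]. *)
Lemma increment_le_deriv h u A n (j : nat) : 0 < h ->
  (forall m, `|delta_right h u m| <= A) ->
  `|u (n + j%:Z) - u n| <= A * (h * j%:R) `^ 1.
Proof.
move=> h0 uA; have hge0 := ltW h0.
rewrite powRr1 ?mulr_ge0//; elim: j => [|j IH].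
  by rewrite addr0 subrr normr0 !mulr0.
rewrite -natr1 -addn1 PoszD addrA distrC.
have := uA (n + j%:Z); rewrite /delta_right normrM normfV (ger0_norm hge0).
rewrite ler_pdivrMr// => uS.
apply: le_trans (ler_distD (u (n + j%:Z)) _ _) _.
by rewrite 2!mulrDr mulr1 lerD// distrC.
Qed.

Lemma frac_delta_right_holder_deriv h a b u A n (N : nat) :
  0 < h -> 0 < a < 1 -> 0 < b < a -> (forall n, `|u n| <= A) ->
  (forall n (j : nat), `|delta_right h u (n + j%:Z) - delta_right h u n|
                         <= A * (h * j%:R) `^ b) ->
  `|frac_delta_right h a u (n + N%:Z) - frac_delta_right h a u n|
    <= ((1 - a)^-1 + b / (a - b)) * A * (h * N%:R) `^ (b - a + 1).
Proof.
move=> h0 a01 /andP[b0 ba] uA uH; have /andP[a0 a1] := a01.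
have A0 : 0 <= A by exact: le_trans (uA 0).
case: N => [|N'].
  by rewrite addr0 subrr normr0 mulr0 powR0 ?mulr0// gt_eqF//; lra.
set N := N'.+1; have N0 : 0 < N%:R :> R by rewrite ltr0n.
rewrite (frac_delta_right_diff h a u A)//.
have ha0 : 0 < h `^ a by exact: powR_gt0.
have Na0 : 0 < N%:R `^ a :> R by exact: powR_gt0.
have [hge0 Nge0] := (ltW h0, ltW N0).
pose c := A * h * h `^ b.
have c0 : 0 <= c by rewrite !mulr_ge0 ?powR_ge0.
have -> : ((1 - a)^-1 + b / (a - b)) * A * (h * N%:R) `^ (b - a + 1)
    = (h `^ a)^-1 * (c * (N%:R `^ b * (1 / (1 - a) * N%:R `^ (1 - a))
                       + N%:R * (b / (a - b) * N%:R `^ (b - a)))).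
  rewrite powRM// !powRD ?(gt_eqF h0) ?(gt_eqF N0) ?implybT// !powRN !powRr1//.
  by rewrite /c; field; rewrite !gt_eqF ?subr_gt0.
apply: (norm_frac_delta_right_le _ _ _ (A + A)) => //.
  by move=> k; rewrite (le_trans (ler_normB _ _))// lerD.
(* A unit increment of [u] is [- h] times its right difference, so the Hölder bound on
   [delta_right h u] transfers. *)
have du (p q : int) (j : nat) m : p = q + j%:Z ->
   `|u (p + m + 1) - u (p + m) - (u (q + m + 1) - u (q + m))|
      <= h * (A * (h * j%:R) `^ b).
  move=> ->; have := uH (q + m) j.
  rewrite -(ler_pM2l h0) -[X in X * `|_|](ger0_norm hge0) -normrM.
  rewrite /delta_right mulrBr ![h * _]mulrC !divfK ?gt_eqF// -normrN [(_ * h)]mulrC.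
  rewrite (addrAC q m).
  by congr (`|_| <= _); ring.
have incr (j : nat) : `|u (n + j%:Z + N%:Z) - u (n + j%:Z) - (u (n + N%:Z) - u n)|
    <= c * (Num.min j%:R N%:R * Num.max j%:R N%:R `^ b).
  (* Telescoping runs over the shorter of [j] and [N], comparing points separated by the longer. *)
  have [jN|jN] := leP j%:R (N%:R : R).
    have := @iter_increment_le u (n + N%:Z) n j _ (fun m => du _ n N m erefl).
    rewrite (addrAC n j%:Z).
    rewrite powRM// [X in `|X|](_ : _ = u (n + N%:Z + j%:Z) - u (n + j%:Z) - (u (n + N%:Z) - u n)); last by ring.
    by move=> /le_trans; apply; rewrite /c le_eqVlt; apply/orP; left; apply/eqP; ring.
  have := @iter_increment_le u (n + j%:Z) n N _ (fun m => du _ n j m erefl).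
  rewrite powRM//.
  by move=> /le_trans; apply; rewrite /c le_eqVlt; apply/orP; left; apply/eqP; ring.
move=> m.
have s1 := sum_Lambda_minr_le _ _ _ m a01 a1 N0.
have s2 : \sum_(0 <= j < m) `|Lambda a j| * (Num.max j%:R N%:R `^ b - N%:R `^ b)
    <= b / (a - b) * N%:R `^ (b - a).
  by apply: sum_Lambda_maxr_le; rewrite ?b0.
(* Rests on [min * max^b = N^b * min + N * (max^b - N^b)], with [min] and [max] taken of [j] and
   [N]: the first term is summed with exponent 1, the second with exponent [b < a]. *)
apply: le_trans (ler_wpM2l c0 (lerD (ler_wpM2l (powR_ge0 _ b) s1) (ler_wpM2l Nge0 s2))).
rewrite !mulr_sumr -big_split/= mulr_sumr; apply: ler_sum => j _.
apply: le_trans (ler_wpM2l (normr_ge0 _) (incr j)) _.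
rewrite le_eqVlt; apply/orP; left; apply/eqP.
rewrite powRr1; last by rewrite le_min ler0n.
by case: leP => _; ring.
Qed.

End frac_estimates.

(** * Passage between extended-real Hölder norms and pointwise bounds *)

Section holder_norms.
Context {R : realType}.
Implicit Types (b h A M : R) (u v : int -> R).
Local Open Scope ereal_scope.

(** The Hölder quotient is symmetric in its two points, so forward increments suffice. *)
Lemma holder_norm_le h k b u M N : (0 < h)%R ->
  (forall l s n, (l + s <= k)%N -> `|delta_rl h l s u n| <= M)%R ->
  (forall l s n (j : nat), (l + s)%N = k ->
    `|delta_rl h l s u (n + j%:Z) - delta_rl h l s u n|
      <= N * (h * j%:R) `^ b)%R ->
  holder_norm h k b u <= (M + N)%:E.
Proof.
move=> h0 uM uN; rewrite EFinD; apply: leeD.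
  apply/bigmax_leP; split => [|p /uM pM]; first exact: leNye.
  exact: sup_norm_le.
apply/bigmax_leP; split => [|p /eqP /uN pN]; first exact: leNye.
apply: ge_ereal_sup => _ [[m n]/= mn <-]; rewrite lee_fin.
have le_nat (i : int) (j : nat) : (0 < j)%N ->
    (`|delta_rl h p.1 p.2 u (i + j%:Z) - delta_rl h p.1 p.2 u i|
     / (h `^ b * `|j%:R| `^ b) <= N)%R.
  move=> j0; have hj : (0 < h * j%:R)%R by rewrite mulr_gt0 ?ltr0n.
  by rewrite normr_nat -powRM ?ler0n ?(ltW h0)// ler_pdivrMr ?powR_gt0//.
have [nm|mn'|/eqP] := ltrgtP n m; last by rewrite eq_sym (negPf mn).
- have := le_nat n `|m - n|%N; rewrite absz_gt0 subr_eq0 => /(_ mn).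
  by rewrite natr_absz intr_norm normr_id gez0_abs ?subr_ge0 ?(ltW nm)// subrKC.
- have := le_nat m `|n - m|%N; rewrite absz_gt0 subr_eq0 eq_sym => /(_ mn).
  rewrite natr_absz intr_norm normr_id gez0_abs ?subr_ge0 ?(ltW mn')// subrKC distrC.
  by rewrite -[(m - n)%R]opprB mulrNz normrN.
Qed.

Lemma holder_space_bounds h k b u : (0 < h)%R -> (0 < b)%R ->
  holder_space h k b u -> exists A : R,
  [/\ holder_norm h k b u = A%:E,
      forall l s n, (l + s <= k)%N -> (`|delta_rl h l s u n| <= A)%R &
      forall l s n (j : nat), (l + s)%N = k ->
        (`|delta_rl h l s u (n + j%:Z) - delta_rl h l s u n|
          <= A * (h * j%:R) `^ b)%R].
Proof.
move=> h0 b0; rewrite /holder_space/= => uoo.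
set S := \big[maxe/-oo]_(p : 'I_k.+1 * 'I_k.+1 | (p.1 + p.2 <= k)%N)
  sup_norm (delta_rl h p.1 p.2 u).
set H := \big[maxe/-oo]_(p : 'I_k.+1 * 'I_k.+1 | (p.1 + p.2 == k)%N)
  holder_seminorm h b (delta_rl h p.1 p.2 u).
have uS l s n : (l + s <= k)%N -> `|delta_rl h l s u n|%:E <= S.
  move=> lsk; have lk : (l < k.+1)%N by lia.
  have sk : (s < k.+1)%N by lia.
  apply: (bigmax_sup (Ordinal lk, Ordinal sk)) => //=.
  by apply: ereal_sup_ubound; exists n.
have uH l s m n : (l + s)%N = k -> m != n ->
    (`|delta_rl h l s u m - delta_rl h l s u n|
      / (h `^ b * `|(m - n)%:~R| `^ b))%:E <= H.
  move=> lsk mn; have lk : (l < k.+1)%N by lia.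
  have sk : (s < k.+1)%N by lia.
  apply: (bigmax_sup (Ordinal lk, Ordinal sk)); first by rewrite /= lsk.
  by apply: ereal_sup_ubound; exists (m, n).
(* The indices [(0, 0)] and [(k, 0)] keep both maxima off the neutral [-oo]; being nonnegative, each
   is bounded by the sum. *)
have S0 : 0 <= S by apply: le_trans (uS 0%N 0%N 0%R _); rewrite ?lee_fin.
have H0 : 0 <= H.
  apply: le_trans (uH k 0%N 0%R 1%R _ _); rewrite ?addn0//.
  by rewrite lee_fin divr_ge0// mulr_ge0 ?powR_ge0.
have SH : S + H < +oo by [].
have Nfin : S + H \is a fin_num by rewrite ge0_fin_numE ?adde_ge0.
exists (fine (S + H)); split.
- by rewrite fineK.
- by move=> l s n lsk; rewrite -lee_fin fineK// (le_trans (uS l s n lsk))// leeDl.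
move=> l s n [|j] lsk.
  by rewrite addr0 subrr normr0 mulr0 powR0 ?mulr0// gt_eqF.
have hj : (0 < h * j.+1%:R)%R by rewrite mulr_gt0 ?ltr0n.
rewrite -ler_pdivrMr ?powR_gt0// -lee_fin fineK//.
have nj : (n + j.+1%:Z)%R != n by rewrite -subr_eq0 addrAC subrr add0r.
have := uH l s _ _ lsk nj.
rewrite [(n + _ - n)%R]addrAC subrr add0r -pmulrn normr_nat -powRM ?ler0n ?(ltW h0)//.
by move=> /le_trans; apply; rewrite leeDr.
Qed.

Lemma holder_space_and_le h k k' b b' c d A u v : (0 < h)%R ->
  holder_norm h k' b' u = A%:E ->
  (forall l s n, (l + s <= k)%N -> `|delta_rl h l s v n| <= c * A)%R ->
  (forall l s n (j : nat), (l + s)%N = k ->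
    `|delta_rl h l s v (n + j%:Z) - delta_rl h l s v n|
      <= d * A * (h * j%:R) `^ b)%R ->
  holder_space h k b v /\
  holder_norm h k b v <= (c + d)%:E * holder_norm h k' b' u.
Proof.
move=> h0 -> vc vd; have := holder_norm_le _ _ _ _ _ _ h0 vc vd.
rewrite -mulrDl EFinM /holder_space/= => vA; split => //.
by apply: le_lt_trans vA _; rewrite -EFinM ltry.
Qed.

Lemma delta_rl_bounded h l s u M : (0 < h)%R -> (forall n, `|u n| <= M)%R ->
  exists N, forall n, (`|delta_rl h l s u n| <= N)%R.
Proof.
move=> h0 uM; have bdd (f : (int -> R) -> int -> R) i :
    (forall v M', (forall n, `|v n| <= M')%R ->
      exists N, forall n, (`|f v n| <= N)%R) ->
    forall v M', (forall n, `|v n| <= M')%R ->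
      exists N, forall n, (`|iter i f v n| <= N)%R.
  move=> fb v M' vM'; elim: i => [|i [N vN]]; first by exists M'.
  exact: fb vN.
have diff v (d : int) M' n : (forall n, `|v n| <= M')%R ->
    (`|(v n - v (n + d)) / h| <= (M' + M') / h)%R.
  move=> vM'; rewrite normrM [`|h^-1|%R]ger0_norm ?invr_ge0 ?(ltW h0)//.
  by rewrite ler_wpM2r ?invr_ge0 ?(ltW h0)// (le_trans (ler_normB _ _))// lerD.
have [N sN] : exists N, forall n, (`|iter s (delta_left h) u n| <= N)%R.
  by apply: bdd uM => v M' vM'; exists ((M' + M') / h)%R => n; exact: diff.
by apply: bdd sN => v M' vM'; exists ((M' + M') / h)%R => n; exact: diff.
Qed.

(** Distinct mesh points are at least [h] apart, so every Hölder quotient is at most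
    [(N + N) / h^b]. *)
Lemma bounded_holder_space h k b u M : (0 < h)%R -> (0 <= b)%R ->
  (forall n, `|u n| <= M)%R -> holder_space h k b u.
Proof.
move=> h0 b0 uM; have M0 : (0 <= M)%R by exact: le_trans (uM 0%R).
have hb0 : (0 < h `^ b)%R by exact: powR_gt0.
have [N N0 uN] : exists2 N, (0 <= N)%R & forall l s n, (l + s <= k)%N ->
    (`|delta_rl h l s u n| <= N)%R.
  pose P l s N := (forall n, `|delta_rl h l s u n| <= N)%R.
  have /choice[F PF] : forall p : nat * nat, exists N, P p.1 p.2 N.
    by move=> p; exact: delta_rl_bounded uM.
  have F0 p : (0 <= F p)%R by exact: le_trans (PF p 0%R).
  (* A finite sum of nonnegative bounds stands in for their maximum. *)
  exists (\sum_(p : 'I_k.+1 * 'I_k.+1) F (p.1 : nat, p.2 : nat))%R.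
    exact: sumr_ge0.
  move=> l s n lsk; have lk : (l < k.+1)%N by lia.
  have sk : (s < k.+1)%N by lia.
  apply: le_trans (PF (l, s) n) _.
  by rewrite (bigD1 (Ordinal lk, Ordinal sk))//= lerDl sumr_ge0.
rewrite /holder_space/=.
apply: le_lt_trans (@holder_norm_le h k b u N ((N + N) / h `^ b) h0 uN _) (ltry _).
move=> l s n [|j] lsk.
  by rewrite addr0 subrr normr0 mulr_ge0 ?powR_ge0// divr_ge0 ?addr_ge0 ?powR_ge0.
rewrite powRM ?ler0n ?(ltW h0)// mulrA divfK ?gt_eqF//.
apply: le_trans (ler_normB _ _) _.
apply: (@le_trans _ _ (N + N)%R); first by rewrite lerD// uN ?lsk.
rewrite ler_peMr ?addr_ge0//.
apply: (@le_trans _ _ (1 `^ b)%R); first by rewrite powR1.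
by rewrite ge0_ler_powR ?nnegrE ?ler1n.
Qed.

End holder_norms.

Theorem theorem2 (R : realType) (alpha beta : R)
    (hbeta : 0 < beta <= 1) (halpha : 0 < alpha < 1) :
  (alpha < beta ->
     exists C : R, 0 < C /\
       forall (h : R) (u : int -> R), 0 < h -> holder_space h 0 beta u ->
         holder_space h 0 (beta - alpha) (frac_delta_right h alpha u) /\
         (holder_norm h 0 (beta - alpha) (frac_delta_right h alpha u)
          <= C%:E * holder_norm h 0 beta u)%E)
  /\
  (alpha < beta ->
     exists C : R, 0 < C /\
       forall (h : R) (u : int -> R), 0 < h -> holder_space h 1 beta u ->
         holder_space h 1 (beta - alpha) (frac_delta_right h alpha u) /\
         (holder_norm h 1 (beta - alpha) (frac_delta_right h alpha u)
          <= C%:E * holder_norm h 1 beta u)%E)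
  /\
  (beta < alpha ->
     exists C : R, 0 < C /\
       forall (h : R) (u : int -> R), 0 < h -> holder_space h 1 beta u ->
         holder_space h 0 (beta - alpha + 1) (frac_delta_right h alpha u) /\
         (holder_norm h 0 (beta - alpha + 1) (frac_delta_right h alpha u)
          <= C%:E * holder_norm h 1 beta u)%E)
  /\
  (forall (h : R) (k : nat) (u : int -> R), 0 < h -> holder_space h k beta u ->
     k%:R + beta - alpha \isn't a Num.int -> alpha < k%:R + beta ->
     let l := Num.truncn (k%:R + beta - alpha) in
     let s := k%:R + beta - alpha - l%:R in
     holder_space h l s (frac_delta_right h alpha u)).
Proof.
have /andP[b0 b1] := hbeta; have /andP[a0 a1] := halpha.
split; [|split; [|split]].
- move=> ab; have ba0 : 0 < beta - alpha by rewrite subr_gt0.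
  pose c := beta / (beta - alpha) * 2.
  have c0 : 0 < c by rewrite mulr_gt0// divr_gt0.
  exists (c + c); split; first exact: addr_gt0.
  move=> h u h0 /(holder_space_bounds _ _ _ _ h0 b0)[A [uA sA hA]].
  apply: (holder_space_and_le _ _ _ _ _ _ _ _ _ _ h0 uA).
  + case=> [|l] [|s] n // _; rewrite -mulrA; apply: frac_delta_right_sup => //.
      by move=> m; exact: (sA 0%N 0%N).
    by move=> m j; exact: (hA 0%N 0%N).
  + case=> [|l] [|s] n j // _; rewrite /c -[_ * 2 * A]mulrA.
    apply: frac_delta_right_holder => //.
      by move=> m; exact: (sA 0%N 0%N).
    by move=> m i; exact: (hA 0%N 0%N).
- move=> ab; have ba0 : 0 < beta - alpha by rewrite subr_gt0.
  pose c := beta / (beta - alpha) * 2.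
  have c0 : 0 < c by rewrite mulr_gt0// divr_gt0.
  pose d := 1 / (1 - alpha) * 2.
  have d0 : 0 < d by rewrite mulr_gt0// divr_gt0// subr_gt0.
  (* [c + d] dominates the order-zero supremum bound [d] and the order-one bounds [c]; the last [c]
     is for the seminorms. *)
  exists ((c + d) + c); split; first by rewrite !addr_gt0.
  move=> h u h0 /(holder_space_bounds _ _ _ _ h0 b0)[A [uA sA hA]].
  have A0 : 0 <= A by exact: le_trans (sA 0%N 0%N 0 _).
  have uM n : `|u n| <= A by exact: (sA 0%N 0%N).
  (* The order-one norm contains no seminorm of [u] itself; the bound on its right difference gives
     a Lipschitz bound, hence [d] is the constant at exponent 1. *)
  have sup0 n : `|frac_delta_right h alpha u n| <= d * A.
    rewrite -mulrA; apply: frac_delta_right_sup => // m j.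
    by apply: increment_le_deriv => // i; exact: (sA 1%N 0%N).
  have dr : delta_right h (frac_delta_right h alpha u)
      = frac_delta_right h alpha (delta_right h u).
    exact: delta_right_frac uM.
  have dl : delta_left h (frac_delta_right h alpha u)
      = frac_delta_right h alpha (delta_left h u).
    exact: delta_left_frac uM.
  have dA : d * A <= (c + d) * A by rewrite ler_wpM2r// lerDr ltW.
  have cA : c * A <= (c + d) * A by rewrite ler_wpM2r// lerDl ltW.
  apply: (holder_space_and_le _ _ _ _ _ _ _ _ _ _ h0 uA).
  + case=> [|[|l]] [|[|s]] n // _.
    * exact: le_trans (sup0 n) dA.
    * apply: le_trans cA; rewrite /delta_rl/= dl -mulrA.
      apply: frac_delta_right_sup => // m; first exact: (sA 0%N 1%N).
      by move=> j; exact: (hA 0%N 1%N).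
    * apply: le_trans cA; rewrite /delta_rl/= dr -mulrA.
      apply: frac_delta_right_sup => // m; first exact: (sA 1%N 0%N).
      by move=> j; exact: (hA 1%N 0%N).
  + case=> [|[|l]] [|[|s]] n j // _; rewrite /c -[_ * 2 * A]mulrA /delta_rl/=.
    * rewrite dl; apply: frac_delta_right_holder => // m.
        exact: (sA 0%N 1%N).
      by move=> i; exact: (hA 0%N 1%N).
    * rewrite dr; apply: frac_delta_right_holder => // m.
        exact: (sA 1%N 0%N).
      by move=> i; exact: (hA 1%N 0%N).
- move=> ba.
  pose c := (1 - alpha)^-1 + beta / (alpha - beta).
  have c0 : 0 < c by rewrite addr_gt0 ?divr_gt0 ?invr_gt0 ?subr_gt0.
  pose d := 1 / (1 - alpha) * 2.
  have d0 : 0 < d by rewrite mulr_gt0// divr_gt0// subr_gt0.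
  exists (d + c); split; first by rewrite addr_gt0.
  move=> h u h0 /(holder_space_bounds _ _ _ _ h0 b0)[A [uA sA hA]].
  have uM n : `|u n| <= A by exact: (sA 0%N 0%N).
  apply: (holder_space_and_le _ _ _ _ _ _ _ _ _ _ h0 uA).
  + case=> [|l] [|s] n // _; rewrite -mulrA; apply: frac_delta_right_sup => // m j.
    by apply: increment_le_deriv => // i; exact: (sA 1%N 0%N).
  + case=> [|l] [|s] n j // _; apply: frac_delta_right_holder_deriv => //.
      by rewrite b0.
    by move=> m i; exact: (hA 1%N 0%N).
(* Only membership at a fixed [h] is claimed, so boundedness of the fractional difference suffices
   once [s >= 0]. *)
- move=> h k u h0 /(holder_space_bounds _ _ _ _ h0 b0)[A [_ sA _]] _ akb /=.
  apply: (@bounded_holder_space _ _ _ _ _ _ h0).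
    by rewrite subr_ge0 truncn_le// subr_ge0 ltW.
  move=> n; apply: frac_delta_right_bounded => // m.
  exact: (sA 0%N 0%N).
Qed.
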